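(* Let $G$ be a group and $F\leqslant G$ a subgroup such that $G=F\cdot \mathsf{FC}_G(F)$. Let $(X,\pi)$ be a uniformly convex isometric Banach $G$-module without almost invariant unit vectors and such that $X^{\mathsf{FC}_G(F)}=\{0\}$. Then the restriction map $$H^1(G,X)\rightarrow H^1(F,X)$$ is zero. In other words, if $G$ acts on $X$ by an affine isometric action $\alpha$ with linear part $\pi$, then $F$ fixes a point of $X$ (there is $x\in X$ with $\alpha(f)x=x$ for all $f\in F$).
   Context: All Banach spaces are real and groups are discrete. A Banach $G$-module is a pair $(X,\pi)$ with $X$ a Banach space and $\pi$ an action of $G$ on $X$ by bounded linear automorphisms; it is isometric if each $\pi(g)$ is an isometry, and it is called uniformly convex if $X$ is: for every $\epsilon>0$ there is $\delta>0$ with $\|\frac{x+y}2\|\leqslant 1-\delta$ whenever $\|x\|=\|y\|=1$ and $\|x-y\|\geqslant\epsilon$. For $H\leqslant G$, $X^H=\{x\in X: \pi(h)x=x\ \forall h\in H\}$. An isometric Banach $G$-module $(X,\pi)$ has almost invariant unit vectors if for all finite $E\subseteq G$ and $\epsilon>0$ there is a unit vector $x\in X$ with $\|x-\pi(g)x\|<\epsilon$ for all $g\in E$. For a subgroup $F\leqslant G$, $\mathsf{FC}_G(F)=\{g\in G: \{fgf^{-1}: f\in F\}\text{ is finite}\}$; this is a subgroup of $G$ normalised by $F$. $Z^1(G,X)$ is the space of maps $\phi:G\to X$ with $\phi(gf)=\pi(g)\phi(f)+\phi(g)$ for all $g,f\in G$; $B^1(G,X)$ is the subspace of maps of the form $g\mapsto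 x-\pi(g)x$ with $x\in X$; $H^1(G,X)=Z^1(G,X)/B^1(G,X)$. The restriction map is induced by $\phi\mapsto\phi|_F$, with $X$ regarded as an $F$-module by restriction. An affine isometric action $\alpha$ with linear part $\pi$ is an action of the form $\alpha(g)x=\pi(g)x+\phi(g)$ with $\phi\in Z^1(G,X)$. *)

(* Defs.v *)
From HB Require Import structures.
From mathcomp Require Import all_boot all_order all_algebra.
From mathcomp Require Import all_classical all_reals all_analysis.

Set Implicit Arguments.
Unset Strict Implicit.
Unset Printing Implicit Defensive.

Import Order.TTheory GRing.Theory Num.Theory numFieldNormedType.Exports.

Local Open Scope classical_set_scope.
Local Open Scope ring_scope.

(* [groupType] is the possibly infinite group structure of boot/monoid.v, not  *)
(* a [finGroupType]. A subgroup is a [groupClosed] predicate; since H^1 takes  *)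
(* a group, its carrier is also packaged as a [groupType].                     *)

Section Subgroup.
Variables (G : groupType) (F : groupClosed G).

Record subgroup := Subgroup { subgroup_val : G; _ : subgroup_val \in F }.

HB.instance Definition _ := [isSub of subgroup for subgroup_val].
HB.instance Definition _ := [Choice of subgroup by <:].

Fact subgroup_closed : group_closed F.
Proof.
split; first exact: gpred1.
by move=> x y xF yF; rewrite gpredM ?gpredV.
Qed.

HB.instance Definition _ :=
  SubChoice_isSubGroup.Build G (fun x => x \in F) subgroup subgroup_closed.

Definition FC : set G :=
  [set g | finite_set [set (f * g * f^-1)%g | f in [set` F]]].

End Subgroup.

Definition is_action (G : groupType) (T : Type) (a : G -> T -> T) : Prop :=
  (forall x, a 1%g x = x) /\ (forall g h x, a (g * h)%g x = a g (a h x)).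

(* Each [act g] is bijective by [act_is_action], with bounded inverse          *)
(* [act g^-1].                                                                 *)
Record banachModule (R : realType) (G : groupType)
    (X : completeNormedModType R) := BanachModule {
  act :> G -> {linear X -> X};
  act_is_action : is_action (fun g => act g);
  act_bounded : forall g, exists C : R, forall x, `|act g x| <= C * `|x|
}.

Definition is_isometric (R : realType) (G : groupType)
    (X : completeNormedModType R) (M : banachModule G X) : Prop :=
  forall g x, `|M g x| = `|x|.

Definition uniformly_convex (R : realType) (X : completeNormedModType R) : Prop :=
  forall e : R, 0 < e -> exists2 d : R, 0 < d &
    forall x y : X, `|x| = 1 -> `|y| = 1 -> e <= `|x - y| ->
      `|2^-1 *: (x + y)| <= 1 - d.

Definition has_almost_invariant_unit_vectors (R : realType) (G : groupType)
    (X : completeNormedModType R) (M : banachModule G X) : Prop :=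
  forall (E : set G) (e : R), finite_set E -> 0 < e ->
    exists2 x : X, `|x| = 1 & forall g, E g -> `|x - M g x| < e.

Definition invariants (R : realType) (G : groupType)
    (X : completeNormedModType R) (M : banachModule G X) (H : set G) : set X :=
  [set x | forall h, H h -> M h x = x].

Section Restriction.
Variables (R : realType) (G : groupType) (X : completeNormedModType R).
Variables (M : banachModule G X) (F : groupClosed G).

Fact res_is_action : is_action (fun f : subgroup F => M (val f)).
Proof.
have [M1 MM] := act_is_action M.
by split=> [x|g h x]; rewrite ?val1 ?valM.
Qed.

Definition res_module : banachModule (subgroup F) X :=
  BanachModule res_is_action (fun f => act_bounded M (val f)).

End Restriction.

Section Cohomology.
Variables (R : realType) (G : groupType) (X : completeNormedModType R).
Variable M : banachModule G X.

Definition is_cocycle (phi : G -> X) : Prop :=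
  forall g f, phi (g * f)%g = M g (phi f) + phi g.

Definition cocycle_pred : {pred G -> X} := fun phi => `[< is_cocycle phi >].

Fact cocycle_zmod_closed : zmod_closed cocycle_pred.
Proof.
split=> [|phi psi /asboolP phiZ /asboolP psiZ]; apply/asboolP => g f.
  by rewrite /= linear0 addr0.
have -> : forall h, (phi - psi) h = phi h - psi h by [].
by rewrite phiZ psiZ linearB opprD addrACA.
Qed.

HB.instance Definition _ :=
  GRing.isZmodClosed.Build (G -> X) cocycle_pred cocycle_zmod_closed.

Record Z1 := MkZ1 { Z1_fun :> G -> X; _ : Z1_fun \in cocycle_pred }.

HB.instance Definition _ := [isSub of Z1 for Z1_fun].
HB.instance Definition _ := [Choice of Z1 by <:].
HB.instance Definition _ := [SubChoice_isSubZmodule of Z1 by <:].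

Definition B1 : {pred Z1} :=
  fun phi => `[< exists x, forall g, phi g = x - M g x >].

Fact B1_zmod_closed : zmod_closed B1.
Proof.
split=> [|phi psi /asboolP[x phiE] /asboolP[y psiE]]; apply/asboolP.
  by exists 0 => g; rewrite linear0 subr0.
exists (x - y) => g.
have -> : (phi - psi) g = phi g - psi g by [].
by rewrite phiE psiE (linearB (M g)) !opprB addrACA [RHS]addrACA [- M g x - y]addrC.
Qed.

HB.instance Definition _ := GRing.isZmodClosed.Build Z1 B1 B1_zmod_closed.

(* [{ideal_quot _}] of a [zmodClosed] predicate is a quotient of abelian       *)
(* groups; the scalar action on H^1 is not recorded.                           *)
Definition H1 := {ideal_quot B1}.

HB.instance Definition _ := GRing.Zmodule.on H1.

Definition H1_class (phi : Z1) : H1 := (\pi_{ideal_quot B1} phi)%qT.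

Lemma H1_classP (phi psi : Z1) :
  H1_class phi = H1_class psi <->
  exists x, forall g, phi g - psi g = x - M g x.
Proof.
split=> [/eqP|[x h]].
  by rewrite /H1_class -Quotient.idealrBE => /asboolP.
by apply/eqP; rewrite /H1_class -Quotient.idealrBE; apply/asboolP; exists x.
Qed.

(* When [M] is isometric, these are the affine isometric actions. [is_action]  *)
(* already follows from the cocycle identity.                                  *)
Definition affine_action_with_linear_part (alpha : G -> X -> X) : Prop :=
  is_action alpha /\
  exists phi : Z1, forall g x, alpha g x = M g x + phi g.

End Cohomology.

Section RestrictionMap.
Variables (R : realType) (G : groupType) (X : completeNormedModType R).
Variables (M : banachModule G X) (F : groupClosed G).

Fact res_cocycle (phi : Z1 M) :
  (fun f : subgroup F => phi (val f)) \in cocycle_pred (res_module M F).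
Proof.
by apply/asboolP => g f; rewrite valM; case: phi => phi /= /asboolP ->.
Qed.

Definition Z1_res (phi : Z1 M) : Z1 (res_module M F) := MkZ1 (res_cocycle phi).

Definition H1_res (c : H1 M) : H1 (res_module M F) := H1_class (Z1_res (repr c)).

(* [H1_res] is the map induced by restriction of cocycles. *)
Lemma H1_resE (phi : Z1 M) : H1_res (H1_class phi) = H1_class (Z1_res phi).
Proof.
apply/H1_classP.
have /H1_classP[x h] : H1_class (repr (H1_class phi)) = H1_class phi.
  exact: reprK.
by exists x => f; exact: h.
Qed.

End RestrictionMap.

(* Main.v *)
Require Import Defs.
From mathcomp Require Import all_boot all_order all_algebra.
From mathcomp Require Import all_classical all_reals all_analysis.
From mathcomp Require Import lra.

(** Write [N] for [FC F]. For a finite family of group elements, consider the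
    mean of the corresponding operators, both of the linear action [M] and of
    the affine action [alpha].

    - Means give contractions. There are no almost invariant unit vectors and
      [G = F N], so there are finite sets [s] in [F] and [t] in [N], containing
      [1], such that every vector [x] is moved by at least [e * `|x|] by some
      element of [s] or [t] ([factored_spectral_gap]). By uniform convexity the
      product of the linear means over [s] and over [t] then has norm smaller
      than [1] ([mean_act_contraction]).

    - Means commute. Every element of [N] has finitely many conjugates under
      [F], so [t] can be enlarged to a finite set stable under conjugation by
      [F] ([FC_conj_stable]); its mean commutes with [F], hence with the mean
      over [s] ([mean_affineC]). The product of the two affine means is a
      contraction; its fixed point [x] is thus fixed by each of them
      ([mean_affine_fixed_point]).

    - Displacements are fixed by [t]. For [f] in [F] the point [alpha f x] is
      also fixed by the affine mean over [t], so the displacement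
      [alpha f x - x] is fixed by the linear mean over [t], and by strict
      convexity it is fixed by each element of [t] ([mean_act_fixed]).

    - Displacements do not depend on [t]. Enlarge [t] by any [n] in [N], with
      new fixed point [x'], and let [z = x - x']. Then [z] is fixed by the
      linear mean over [s], so iterating the linear mean over [t] on [z] amounts
      to iterating the contraction and gives a sequence tending to [0]. On the
      other hand [M f z - z] is fixed by [t], so it does not change when [z] is
      replaced by these iterates; it is therefore [0] ([displacement_eq0]).

    Hence [alpha f x - x] is fixed by every [n] in [N], and so it vanishes
    because [N] has no nonzero invariant vector. *)

Set Implicit Arguments.
Unset Strict Implicit.
Unset Printing Implicit Defensive.

Import Order.TTheory GRing.Theory Num.Theory numFieldNormedType.Exports.

Local Open Scope classical_set_scope.
Local Open Scope ring_scope.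

(** * Means of finite families of vectors *)

(** The arithmetic mean of [T i] for [i] in [s], with multiplicity; it is [0]
    when [s] is empty. *)
Definition mean (R : realType) (X : lmodType R) (I : Type) (s : seq I)
    (T : I -> X) : X :=
  (size s)%:R^-1 *: \sum_(i <- s) T i.

Section Mean.
Variables (R : realType) (X : completeNormedModType R).

Lemma size_gt0 (I : eqType) (s : seq I) i : i \in s -> 0 < (size s)%:R :> R.
Proof. by case: s => // j s _; rewrite ltr0n. Qed.

Lemma eq_mean (I : eqType) (s : seq I) (T U : I -> X) :
  {in s, T =1 U} -> mean s T = mean s U.
Proof. by move=> TU; congr (_ *: _); exact: eq_big_seq. Qed.

Lemma mean_cst (I : eqType) (s : seq I) i (x : X) :
  i \in s -> mean s (fun=> x) = x.
Proof.
move=> /size_gt0 s0; rewrite /mean big_const_seq count_predT iter_addr_0.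
by rewrite -[x *+ _]scaler_nat scalerA mulVf ?scale1r// gt_eqF.
Qed.

Lemma meanD (I : Type) (s : seq I) (T U : I -> X) :
  mean s (fun i => T i + U i) = mean s T + mean s U.
Proof. by rewrite /mean big_split scalerDr. Qed.

Lemma meanB (I : Type) (s : seq I) (T U : I -> X) :
  mean s (fun i => T i - U i) = mean s T - mean s U.
Proof. by rewrite /mean sumrB scalerBr. Qed.

Lemma linear_mean (I : Type) (s : seq I) (L : {linear X -> X}) (T : I -> X) :
  L (mean s T) = mean s (fun i => L (T i)).
Proof. by rewrite /mean linearZ linear_sum. Qed.

Lemma exchange_mean (I J : Type) (s : seq I) (t : seq J) (T : I -> J -> X) :
  mean s (fun i => mean t (T i)) = mean t (fun j => mean s (T^~ j)).
Proof.
by rewrite /mean -!scaler_sumr exchange_big /= !scalerA mulrC.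
Qed.

Lemma ler_norm_mean (I : eqType) (s : seq I) (T : I -> X) (C : R) :
  0 <= C -> {in s, forall i, `|T i| <= C} -> `|mean s T| <= C.
Proof.
move=> C0 TC; have [s0|sN0] := eqVneq (size s) 0%N.
  by rewrite /mean s0 invr0 scale0r normr0.
have s0 : 0 < (size s)%:R :> R by rewrite ltr0n lt0n.
rewrite /mean normrZ ger0_norm ?invr_ge0 ?(ltW s0)// ler_pdivrMl//.
apply: le_trans (ler_norm_sum _ _ _) _.
rewrite big_seq; apply: le_trans (ler_sum _ TC) _.
by rewrite -big_seq big_const_seq count_predT iter_addr_0 mulr_natl.
Qed.

End Mean.

(** * Displacement and contraction *)

Section UniformConvexity.
Variables (R : realType) (X : completeNormedModType R).
Hypothesis hUC : uniformly_convex X.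

(** Uniform convexity on spheres of arbitrary radius. *)
Lemma uniformly_convexZ (e : R) : 0 < e -> exists2 d : R, 0 < d &
  forall x y : X, `|y| = `|x| -> e * `|x| <= `|x - y| ->
    `|x + y| <= 2 * (1 - d) * `|x|.
Proof.
move=> /hUC[d d0 h]; exists d => // x y yx exy.
have [x0|xN0] := eqVneq `|x| 0.
  have -> : x = 0 by exact: normr0_eq0.
  have -> : y = 0 by apply: normr0_eq0; rewrite yx.
  by rewrite addr0 normr0 mulr0.
have xgt0 : 0 < `|x| by rewrite lt_neqAle eq_sym xN0 normr_ge0.
have nV : `| `|x|^-1 | = `|x|^-1 by rewrite ger0_norm ?invr_ge0.
have := h (`|x|^-1 *: x) (`|x|^-1 *: y).
rewrite -scalerBr -scalerDr !normrZ nV yx mulVf// ger0_norm ?invr_ge0//.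
move=> /(_ erefl erefl).
rewrite [_^-1 * `|x - y|]mulrC ler_pdivlMr// => /(_ exy).
rewrite mulrA -invfM ler_pdivrMl ?mulr_gt0//; lra.
Qed.

Section Isometric.
Variables (G : groupType) (M : banachModule G X).
Hypothesis hiso : is_isometric M.

Lemma act1 x : M 1%g x = x. Proof. by have [] := act_is_action M. Qed.

Lemma actM g h x : M (g * h)%g x = M g (M h x).
Proof. by have [_] := act_is_action M. Qed.

Lemma ler_norm_mean_act s x : `|mean s (M^~ x)| <= `|x|.
Proof. by apply: ler_norm_mean => // g _; rewrite hiso. Qed.

(** Because [1] is in [s], the sum over [s] contains the two terms [x] and
    [M g x], to which uniform convexity applies. *)
Lemma mean_act_displaced (s : seq G) (e : R) : 1%g \in s -> 0 < e ->
  exists2 d : R, 0 < d & forall x g, g \in s -> e * `|x| <= `|x - M g x| ->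
    `|mean s (M^~ x)| <= (1 - d) * `|x|.
Proof.
move=> s1 e0; have s0 := size_gt0 R s1.
have [d d0 dP] := uniformly_convexZ e0.
exists (2 * d / (size s)%:R); first by rewrite divr_gt0// mulr_gt0.
move=> x g gs exg; have [g1|gN1] := eqVneq g 1%g.
  move: exg; rewrite g1 act1 subrr normr0 pmulr_rle0// normr_le0 => /eqP ->.
  by apply: le_trans (ler_norm_mean_act _ _) _; rewrite normr0 mulr0.
have gs' : g \in rem 1%g s by exact: rem_mem.
rewrite /mean (big_rem 1%g)//= act1 (big_rem g)//= addrA normrZ.
rewrite ger0_norm ?invr_ge0 ?(ltW s0)// ler_pdivrMl//.
apply: le_trans (ler_normD _ _) _.
have h1 : `|x + M g x| <= 2 * (1 - d) * `|x| by apply: dP => //; rewrite hiso.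
have h2 : `|\sum_(h <- rem g (rem 1%g s)) M h x| <= ((size s)%:R - 2) * `|x|.
  apply: le_trans (ler_norm_sum _ _ _) _.
  under eq_bigr do rewrite hiso.
  rewrite big_const_seq count_predT iter_addr_0 -[_ *+ _]mulr_natl.
  have s2 : (0 < size (rem 1%g s))%N by case: (rem _ s) gs'.
  rewrite ler_wpM2r// !size_rem//; rewrite size_rem// in s2.
  by case: (size s) s2 => [|[|m]]//= _; rewrite -addn2 natrD addrK.
apply: le_trans (lerD h1 h2) _.
rewrite mulrA -mulrDl ler_wpM2r//.
by rewrite [leRHS]mulrBr mulr1 [_ * (_ / _)]mulrCA divff ?gt_eqF// mulr1; lra.
Qed.

(** Strict convexity: a vector that is a mean of its translates, which have the
    same norm as it, is equal to each of them. *)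
Lemma mean_act_fixed (s : seq G) x : 1%g \in s -> mean s (M^~ x) = x ->
  {in s, forall g, M g x = x}.
Proof.
move=> s1 sx g gs; apply/eqP/negPn/negP => gx.
have x0 : 0 < `|x|.
  by rewrite normr_gt0; apply: contraNneq gx => ->; rewrite linear0.
have e0 : 0 < `|x - M g x| / `|x|.
  by rewrite divr_gt0// normr_gt0 subr_eq0 eq_sym.
have [d d0 /(_ x g gs)] := mean_act_displaced s1 e0.
rewrite divfK ?gt_eqF// sx => /(_ (lexx _)).
by rewrite leNgt gtr_pMl// ltrBlDr ltrDl d0.
Qed.

(** Either [x] is moved by some element of [t], and the mean over [t] is short,
    or the mean over [t] is close to [x]; if [x] is then moved by some element
    of [s], so is the mean over [t]. *)
Lemma mean_act_contraction (s t : seq G) (e : R) :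
  1%g \in s -> 1%g \in t -> 0 < e ->
  (forall x, x != 0 -> exists2 g, g \in s ++ t & e * `|x| <= `|x - M g x|) ->
  exists2 r : R, 0 <= r < 1 &
    forall x, `|mean s (M^~ (mean t (M^~ x)))| <= r * `|x|.
Proof.
move=> s1 t1 e0 gap; have e4 : 0 < e / 4 by rewrite divr_gt0.
have [ds ds0 sP] := mean_act_displaced s1 (divr_gt0 e0 (ltr0n R 2)).
have [dt dt0 tP] := mean_act_displaced t1 e4.
(* Capping [d] at [1] keeps the ratio [1 - d] nonnegative. *)
pose d := Num.min (Num.min ds dt) 1.
have d0 : 0 < d by rewrite !lt_min ds0 dt0 ltr01.
have dds : d <= ds by rewrite /d !ge_min lexx.
have ddt : d <= dt by rewrite /d !ge_min lexx orbT.
have d1 : d <= 1 by rewrite /d !ge_min lexx !orbT.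
exists (1 - d) => [|x]; first by rewrite subr_ge0 d1 ltrBlDr ltrDl d0.
set y := mean t _; have yx : `|y| <= `|x| by exact: ler_norm_mean_act.
have [[g gt gx]|small] :=
  pselect (exists2 g, g \in t & e / 4 * `|x| <= `|x - M g x|).
  apply: le_trans (ler_norm_mean_act _ _) _.
  by apply: le_trans (tP _ _ gt gx) _; rewrite ler_wpM2r// lerB.
have {}small g : g \in t -> `|x - M g x| < e / 4 * `|x|.
  by move=> gt; rewrite ltNge; apply/negP => gx; apply: small; exists g.
have x0 : x != 0.
  apply/eqP => x0; have := small _ t1.
  by rewrite x0 act1 subrr normr0 mulr0 ltxx.
have xy : `|x - y| <= e / 4 * `|x|.
  rewrite -[x in x - y](mean_cst x t1) -meanB.
  by apply: ler_norm_mean => [|g /small/ltW//]; rewrite mulr_ge0 ?(ltW e4).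
have [g] := gap x x0; rewrite mem_cat => /orP[gs|/small]; last first.
  have : 0 < `|x| by rewrite normr_gt0.
  by move: `|x| => a a0 h1 h2; exfalso; nra.
move=> gx; suff gy : e / 2 * `|y| <= `|y - M g y|.
  apply: le_trans (sP _ _ gs gy) _.
  apply: (@le_trans _ _ ((1 - d) * `|y|)); first by rewrite ler_wpM2r// lerB.
  by rewrite ler_wpM2l// subr_ge0.
have : `|x - M g x| <= `|x - y| + `|y - M g y| + `|x - y|.
  have -> : x - M g x = (x - y) + (y - M g y) + M g (y - x).
    by rewrite linearB !subrKA.
  apply: le_trans (ler_normD _ _) _; rewrite hiso (distrC y) lerD2r.
  exact: ler_normD.
have : e / 2 * `|y| <= e / 2 * `|x| by rewrite ler_wpM2l// ltW ?divr_gt0.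
by move: xy gx; lra.
Qed.

End Isometric.
End UniformConvexity.

(** * Affine actions and means over conjugation-stable sets *)

Section Affine.
Variables (R : realType) (X : completeNormedModType R).
Variables (G : groupType) (F : groupClosed G) (M : banachModule G X).

(** [s] is stable under conjugation by the elements of [F]. *)
Definition conj_stable (s : seq G) :=
  forall f g, f \in F -> g \in s -> (f * g * f^-1)%g \in s.

Lemma conj_stable_FC (s : seq G) : conj_stable s -> {in s, forall g, FC F g}.
Proof.
move=> sS g gs; apply: sub_finite_set (finite_seq s).
by move=> _ [f fF <-]; exact: sS.
Qed.

(** By definition of [FC F], a finite subset of it lies in a finite set that is
    stable under conjugation by [F]. *)
Lemma FC_conj_stable (t : seq G) : {in t, forall g, FC F g} ->
  exists s, [/\ {subset t <= s}, uniq s & conj_stable s].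
Proof.
move=> tFC; pose S := \bigcup_(g in [set` t])
  [set (f * g * f^-1)%g | f in [set` F]].
have /finite_seqP[s sE] : finite_set S.
  by apply: bigcup_finite => [|g /tFC //]; exact: finite_seq.
have sP g : g \in undup s <-> S g by rewrite mem_undup sE.
exists (undup s); split; rewrite ?undup_uniq//.
  move=> g gt; apply/sP; exists g => //; exists 1%g; first exact: gpred1.
  by rewrite invg1 mulg1 mul1g.
move=> f _ fF /sP[g gt [h hF <-]]; apply/sP; exists g => //.
exists (f * h)%g; first exact: gpredM.
by rewrite invgM !mulgA.
Qed.

Variables (alpha : G -> X -> X) (phi : G -> X).
Hypothesis alphaE : forall g x, alpha g x = M g x + phi g.
Hypothesis alphaM : forall g h x, alpha (g * h)%g x = alpha g (alpha h x).

Lemma affine_mean (I : eqType) (s : seq I) i g (T : I -> X) : i \in s ->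
  alpha g (mean s T) = mean s (fun i => alpha g (T i)).
Proof.
move=> si; rewrite alphaE linear_mean -[X in _ + X](mean_cst _ si) -meanD.
by apply: eq_mean => j _; rewrite alphaE.
Qed.

Lemma mean_affineB (s : seq G) x y :
  mean s (alpha^~ x) - mean s (alpha^~ y) = mean s (M^~ (x - y)).
Proof.
rewrite -meanB; apply: eq_mean => g _.
by rewrite !alphaE linearB opprD addrACA subrr addr0.
Qed.

Lemma affine_mean_conj_stable (s : seq G) f x :
  uniq s -> conj_stable s -> 1%g \in s -> f \in F ->
  alpha f (mean s (alpha^~ x)) = mean s (alpha^~ (alpha f x)).
Proof.
move=> su sS s1 fF; rewrite (affine_mean _ _ s1).
pose c g := (f * g * f^-1)%g.
have c_inj : injective c by move=> g h /mulIg/mulgI.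
have sc : perm_eq (map c s) s.
  have cu : uniq (map c s) by rewrite map_inj_uniq.
  apply: uniq_perm => //.
  have [|//|] := @uniq_min_size _ (map c s) s cu; rewrite ?size_map//.
  by move=> _ /mapP[g gs ->]; exact: sS.
rewrite /mean -[in RHS](perm_big _ sc) big_map; congr (_ *: _).
by apply: eq_bigr => g _; rewrite -!alphaM /c mulgVK.
Qed.

Lemma mean_affineC (s t : seq G) x :
  {subset s <= F} -> 1%g \in s -> uniq t -> conj_stable t -> 1%g \in t ->
  mean s (alpha^~ (mean t (alpha^~ x))) = mean t (alpha^~ (mean s (alpha^~ x))).
Proof.
move=> sF s1 tu tS t1.
under [RHS]eq_mean do rewrite (affine_mean _ _ s1).
rewrite exchange_mean; apply: eq_mean => f fs.
by rewrite affine_mean_conj_stable// sF.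
Qed.

End Affine.

Lemma contraction_fixed_point (R : realType) (X : completeNormedModType R)
    (T : X -> X) (r : R) : 0 <= r < 1 ->
  (forall x y, `|T x - T y| <= r * `|x - y|) -> exists x, T x = x.
Proof.
move=> /andP[r0 r1] Tr.
have [|||x _ xT] := @banach_fixed_point R X setT [fun of totalfun T].
- by exists (NngNum r0); split=> // -[x y] _; exact: Tr.
- exact: closedT.
- by exists 0.
- by exists x.
Qed.

(** * The fixed point *)

Section FixedPoint.
Variables (R : realType) (X : completeNormedModType R).
Variables (G : groupType) (F : groupClosed G) (M : banachModule G X).
Hypothesis hUC : uniformly_convex X.
Hypothesis hiso : is_isometric M.
Variables (alpha : G -> X -> X) (phi : G -> X).
Hypothesis alphaE : forall g x, alpha g x = M g x + phi g.
Hypothesis alphaM : forall g h x, alpha (g * h)%g x = alpha g (alpha h x).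

(* The affine and the linear mean over [s]. *)
Let A (s : seq G) x := mean s (alpha^~ x).
Let P (s : seq G) x := mean s (M^~ x).

(** The contraction [A s \o A t] commutes with [A s], which therefore fixes its
    unique fixed point, and likewise for [A t]. *)
Lemma mean_affine_fixed_point (s t : seq G) (r : R) :
  {subset s <= F} -> 1%g \in s -> uniq t -> conj_stable F t -> 1%g \in t ->
  0 <= r < 1 -> (forall x, `|P s (P t x)| <= r * `|x|) ->
  exists2 x, A s x = x & A t x = x.
Proof.
move=> sF s1 tu tS t1 r01 PP.
have AA x y : `|A s (A t x) - A s (A t y)| <= r * `|x - y|.
  by rewrite /A !(mean_affineB alphaE); exact: PP.
have [x xE] := contraction_fixed_point r01 AA.
have AC (y : X) : A s (A t y) = A t (A s y).
  exact: (mean_affineC alphaE alphaM _ sF s1 tu tS t1).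
have uniq_fix (y : X) : A s (A t y) = y -> y = x.
  move=> yE; apply/eqP; rewrite -subr_eq0 -normr_eq0.
  have := AA y x; rewrite yE xE; have := normr_ge0 (y - x).
  case/andP: r01 => _; nra.
by exists x; apply: uniq_fix; [rewrite -AC xE|rewrite AC xE].
Qed.

(** On a vector [z] fixed by [P s], the powers of [P t] agree with those of the
    contraction [P s \o P t], hence send [z] to vectors tending to [0]; but the
    displacement [M f z - z] is unchanged when [z] is replaced by any of the
    vectors [P t z], [P t (P t z)], and so on. *)
Lemma displacement_eq0 (s t : seq G) (r : R) f z :
  {subset s <= F} -> 1%g \in s -> uniq t -> conj_stable F t -> 1%g \in t ->
  0 <= r < 1 -> (forall x, `|P s (P t x)| <= r * `|x|) ->
  f \in F -> P s z = z -> P t (M f z - z) = M f z - z -> M f z = z.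
Proof.
move=> sF s1 tu tS t1 r01 PP fF zE; set y := M f z - z => yE.
have ME g x : M g x = M g x + (fun=> 0 : X) g by rewrite addr0.
have MM g h x : M (g * h)%g x = M g (M h x) by exact: actM.
pose w k := iter k (P t) z.
have wE k : [/\ P s (w k) = w k, M f (w k) - w k = y & `|w k| <= r ^+ k * `|z|].
  elim: k => [|k [IHs IHf IHr]]; first by rewrite expr0 mul1r.
  rewrite /w iterS -/(w k).
  have sw : P s (P t (w k)) = P t (w k).
    rewrite /P (mean_affineC ME MM _ sF s1 tu tS t1).
    by rewrite -[mean s _]/(P s (w k)) IHs.
  split=> //.
    rewrite /P (affine_mean_conj_stable ME MM _ tu tS t1 fF) -[RHS]yE -IHf.
    by rewrite (mean_affineB ME).
  rewrite -sw; apply: le_trans (PP _) _; rewrite exprS -mulrA ler_wpM2l//.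
  by case/andP: r01.
apply/eqP; rewrite -subr_eq0 -/y -normr_eq0.
have yr k : `|y| <= r ^+ k * (2 * `|z|).
  have [_ <- wr] := wE k; apply: le_trans (ler_normB _ _) _.
  by rewrite hiso; move: wr; lra.
rewrite eq_le normr_ge0 andbT.
have r_cvg0 : r ^+ k @[k --> \oo] --> (0 : R).
  by apply: cvg_expr; case/andP: r01 => ? ?; rewrite ger0_norm.
rewrite -(mul0r (2 * `|z|)).
apply: cvgr_to_ge (cvgM r_cvg0 (cvg_cst (2 * `|z|))) _.
by apply: nearW => k; exact: yr.
Qed.

Lemma mean_act_displacement (t : seq G) f x :
  uniq t -> conj_stable F t -> 1%g \in t -> f \in F -> A t x = x ->
  P t (alpha f x - x) = alpha f x - x.
Proof.
move=> tu tS t1 fF xt; rewrite -{3}xt /P -(mean_affineB alphaE).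
by rewrite -(affine_mean_conj_stable alphaE alphaM _ tu tS t1 fF) -/(A t x) !xt.
Qed.

(** Enlarging [t] within [FC F] changes the fixed point [x] only by a vector
    invariant under [F], so the displacement of [x] under [F] is invariant under
    every element of [FC F]. *)
Lemma displacement_FC_invariant (s t : seq G) (e : R) :
  {subset s <= F} -> 1%g \in s -> {in t, forall g, FC F g} -> 1%g \in t ->
  0 < e ->
  (forall x, x != 0 -> exists2 g, g \in s ++ t & e * `|x| <= `|x - M g x|) ->
  exists x, forall f n, f \in F -> FC F n ->
    M n (alpha f x - x) = alpha f x - x.
Proof.
move=> sF s1 tFC t1 e0 gap.
have fixed_point (u : seq G) : {subset t <= u} -> {in u, forall g, FC F g} ->
    exists v x r, [/\ [/\ {subset u <= v}, uniq v & conj_stable F v],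
      A s x = x, A v x = x, 0 <= r < 1 &
      forall x, `|P s (P v x)| <= r * `|x|].
  move=> tu uFC; have [v [uv vu vS]] := FC_conj_stable uFC.
  have v1 : 1%g \in v by apply/uv/tu.
  have [r r01 PP] : exists2 r : R, 0 <= r < 1 &
      forall x, `|P s (P v x)| <= r * `|x|.
    apply: (mean_act_contraction hUC hiso s1 v1 e0) => x /gap[g gst gx].
    exists g => //; move: gst; rewrite !mem_cat => /orP[->//|/tu/uv ->].
    by rewrite orbT.
  have [x xs xv] := mean_affine_fixed_point sF s1 vu vS v1 r01 PP.
  by exists v, x, r.
have [v [x [r [[tv vu vS] xs xv r01 PP]]]] := fixed_point t (fun _ => id) tFC.
have v1 : 1%g \in v := tv _ t1.
exists x => f n fF nFC.
have [|g|v' [x' [_ [[vv' v'u v'S] xs' xv' _ _]]]] := fixed_point (n :: v).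
- by move=> g /tv gv; rewrite inE gv orbT.
- by rewrite inE => /orP[/eqP->//|]; exact: conj_stable_FC.
have v'1 : 1%g \in v' by apply: vv'; rewrite inE v1 orbT.
have c'fix : {in v', forall g, M g (alpha f x' - x') = alpha f x' - x'}.
  by apply: mean_act_fixed => //; exact: mean_act_displacement.
suff -> : alpha f x - x = alpha f x' - x'.
  by apply: c'fix; apply: vv'; exact: mem_head.
have dispB : M f (x - x') - (x - x') = (alpha f x - x) - (alpha f x' - x').
  have -> : M f (x - x') = alpha f x - alpha f x'.
    by rewrite !alphaE linearB opprD addrACA subrr addr0.
  by rewrite !opprD addrACA.
apply/eqP; rewrite -subr_eq0 -dispB subr_eq0; apply/eqP.
apply: (displacement_eq0 sF s1 vu vS v1 r01 PP fF).
  by rewrite /P -(mean_affineB alphaE) -/(A s x) -/(A s x') xs xs'.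
rewrite dispB /P; under eq_mean do rewrite linearB.
rewrite meanB -/(P v _) mean_act_displacement//; congr (_ - _).
rewrite -[RHS](mean_cst _ v1); apply: eq_mean => g gv.
by apply: c'fix; apply: vv'; rewrite inE gv orbT.
Qed.

End FixedPoint.

(** * Spectral gap and vanishing of the restriction map *)

(** A finite set witnessing the absence of almost invariant unit vectors may be
    taken inside the union of [F] and [FC F], at the price of halving the
    constant. *)
Lemma factored_spectral_gap (R : realType) (G : groupType) (F : groupClosed G)
    (X : completeNormedModType R) (M : banachModule G X) :
  [set: G] = [set (f * h)%g | f in [set` F] & h in FC F] ->
  is_isometric M -> ~ has_almost_invariant_unit_vectors M ->
  exists s t (e : R), [/\ {subset s <= F}, 1%g \in s,
    {in t, forall g, FC F g}, 1%g \in t & 0 < e /\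
    forall x, x != 0 -> exists2 g, g \in s ++ t & e * `|x| <= `|x - M g x|].
Proof.
move=> hG hiso hai.
have [E [e [/finite_seqP[q qE] e0 gap]]] : exists E (e : R),
    [/\ finite_set E, 0 < e & forall x : X, `|x| = 1 ->
      exists2 g, E g & e <= `|x - M g x|].
  apply: contrapT => nogap; apply: hai => E e finE e0.
  apply: contrapT => noinv; apply: nogap; exists E, e; split=> // x x1.
  apply: contrapT => small; apply: noinv; exists x => // g Eg.
  by rewrite ltNge; apply/negP => gx; apply: small; exists g.
have /choice[u uP] (g : G) : exists p : G * G,
    [/\ p.1 \in F, FC F p.2 & g = (p.1 * p.2)%g].
  have : [set: G] g by [].
  by rewrite hG => -[f fF [h hFC <-]]; exists (f, h).
exists (1%g :: [seq (u g).1 | g <- q]), (1%g :: [seq (u g).2 | g <- q]).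
exists (e / 2).
rewrite !mem_head; split=> //.
- move=> g; rewrite inE => /orP[/eqP->|/mapP[h _ ->]]; first exact: gpred1.
  by have [] := uP h.
- move=> g; rewrite inE => /orP[/eqP->|/mapP[h _ ->]]; last by have [] := uP h.
  apply: sub_finite_set (finite_set1 1%g) => _ [f _ <-] /=.
  by rewrite mulg1 mulgV.
(* With [g = f h], a vector moved by [g] is moved at least half as much by [f]
   or by [h]. *)
split=> [|x x0]; first by rewrite divr_gt0.
have nx : 0 < `|x| by rewrite normr_gt0.
have nV : `| `|x|^-1 | = `|x|^-1 by rewrite ger0_norm ?invr_ge0.
have [|g] := gap (`|x|^-1 *: x); first by rewrite normrZ nV mulVf ?gt_eqF.
rewrite qE /= linearZ -scalerBr normrZ nV mulrC ler_pdivlMr// => gq.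
have [_ _ gE] := uP g.
set f := (u g).1 in gE; set h := (u g).2 in gE.
have : `|x - M g x| <= `|x - M f x| + `|x - M h x|.
  rewrite -(hiso f (x - M h x)) linearB -(actM M) -gE.
  by rewrite -[x - M g x](subrKA (M f x)); exact: ler_normD.
have [fx _ _|fx] := leP (e / 2 * `|x|) `|x - M f x|.
  have fs : f \in [seq (u k).1 | k <- q] by apply/mapP; exists g.
  by exists f; rewrite // !(inE, mem_cat) fs !orbT.
move=> tri gx; exists h; last by move: fx tri gx; lra.
have ht : h \in [seq (u k).2 | k <- q] by apply/mapP; exists g.
by rewrite !(inE, mem_cat) ht !orbT.
Qed.

Theorem theorem1p1 (R : realType) (G : groupType) (F : groupClosed G)
    (X : completeNormedModType R) (M : banachModule G X)
    (hG : [set: G] = [set (f * h)%g | f in [set` F] & h in FC F])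
    (hUC : uniformly_convex X)
    (hiso : is_isometric M)
    (hai : ~ has_almost_invariant_unit_vectors M)
    (hFC : invariants M (FC F) = [set 0]) :
  (forall c : H1 M, H1_res F c = 0) /\
  (forall alpha : G -> X -> X, affine_action_with_linear_part M alpha ->
    exists x : X, forall f, f \in F -> alpha f x = x).
Proof.
have fixed (alpha : G -> X -> X) (phi : G -> X) :
    (forall g h x, alpha (g * h)%g x = alpha g (alpha h x)) ->
    (forall g x, alpha g x = M g x + phi g) ->
    exists x : X, forall f, f \in F -> alpha f x = x.
  move=> alphaM alphaE.
  have [s [t [e [sF s1 tFC t1 [e0 gap]]]]] := factored_spectral_gap hG hiso hai.
  have [x xP] :=
    displacement_FC_invariant hUC hiso alphaE alphaM sF s1 tFC t1 e0 gap.
  exists x => f fF; apply/eqP; rewrite -subr_eq0; apply/eqP.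
  have : invariants M (FC F) (alpha f x - x) by move=> n; exact: xP.
  by rewrite hFC.
split=> [c|alpha [[_ alphaM] [phi alphaE]]]; last exact: fixed alphaM alphaE.
have phiZ : is_cocycle M (repr c) by case: (repr c) => phi /= /asboolP.
have [|//|x xP] := fixed (fun g x => M g x + repr c g) (repr c).
  by move=> g h x; rewrite phiZ (actM M) linearD addrA.
have -> : 0 = H1_class 0 :> H1 (res_module M F) by rewrite /H1_class piE.
apply/H1_classP; exists x => f.
by rewrite subr0 -[X in X - _](xP _ (valP f)) addrC addKr.
Qed.
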